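(* Let $F$ be a field where $2$ is invertible. Then the alternative exterior algebra $\Lambda'(F^3)$ is (isomorphic to) the Kingdon algebra $K(F^3,0)$, where $0$ denotes the zero bilinear form on $F^3$.
   Context: Algebras over $F$ are unital but not necessarily associative. The alternative exterior algebra $\Lambda'(F^3)$ is the eight-dimensional $F$-algebra with basis consisting of the eight symbols $1,i,j,k,ij,jk,ki,\omega$, where $1$ is the identity element, and where the only nonzero products of two non-identity basis elements are $$i\cdot j=ij,\quad j\cdot i=-ij,\quad j\cdot k=jk,\quad k\cdot j=-jk,\quad k\cdot i=ki,\quad i\cdot k=-ki,$$ $$(ij)\cdot k=(jk)\cdot i=(ki)\cdot j=\omega,\qquad k\cdot(ij)=i\cdot(jk)=j\cdot(ki)=-\omega;$$ all other products of two non-identity basis elements are $0$. An algebra is alternative if $x(xy)=(xx)y$ and $y(xx)=(yx)x$ for all elements $x,y$. $\mathrm{Alt}[V]$ denotes the free (unital) alternative $F$-algebra over a vector space $V$: it is alternative, contains $V$ as a subspace and $F=F1$, and each linear map from $V$ to an alternative $F$-algebra extends uniquely to an $F$-algebra homomorphism on $\mathrm{Alt}[V]$. For a finite-dimensional $V$ with symmetric bilinear form $B$, the Kingdon algebra is $K(V,B)=\mathrm{Alt}[V]/I_B$, where $I_B$ is the two-sided ideal generated by all elements $uv+vu-B(u,v)\cdot 1$ and $(uv)w-w(vu)$ with $u,v,w\in V$. *)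

(* Defs.v *)
From HB Require Import structures.
From mathcomp Require Import all_boot all_order all_algebra.
From mathcomp Require Import sesquilinear generic_quotient ring_quotient.
From mathcomp Require Import boolp.

Set Implicit Arguments.
Unset Strict Implicit.
Unset Printing Implicit Defensive.

Import GRing.Theory.
Local Open Scope ring_scope.
Local Open Scope quotient_scope.

Declare Scope nonassoc_scope.
Delimit Scope nonassoc_scope with NA.
Local Open Scope nonassoc_scope.

(* MathComp's algebras are all associative, hence this structure. *)
HB.mixin Record Lmodule_isNonassocAlgebra (F : fieldType) A
    of GRing.Lmodule F A := {
  naone : A;
  namul : A -> A -> A;
  namul1x : left_id naone namul;
  namulx1 : right_id naone namul;
  namulDl : left_distributive namul +%R;
  namulDr : right_distributive namul +%R;
  namulZl : forall (c : F) (x y : A), namul (c *: x) y = c *: namul x y;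
  namulZr : forall (c : F) (x y : A), namul x (c *: y) = c *: namul x y
}.

#[short(type="nonassocAlgType")]
HB.structure Definition NonassocAlgebra (F : fieldType) :=
  {A of Lmodule_isNonassocAlgebra F A & GRing.Lmodule F A}.

Reserved Notation "x ** y" (at level 40, left associativity).
Notation "x ** y" := (namul x y) : nonassoc_scope.

Definition alternative (F : fieldType) (A : nonassocAlgType F) : Prop :=
  (forall x y : A, x ** (x ** y) = (x ** x) ** y) /\
  (forall x y : A, y ** (x ** x) = (y ** x) ** x).

Definition alg_morphism (F : fieldType) (A B : nonassocAlgType F)
    (f : A -> B) : Prop :=
  [/\ linear f,
      f naone = naone
    & forall x y : A, f (x ** y) = f x ** f y].

Definition alg_isomorphic (F : fieldType) (A B : nonassocAlgType F) : Prop :=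
  exists2 f : A -> B, alg_morphism f & bijective f.

Section NonassocTheory.
Variables (F : fieldType) (A : nonassocAlgType F).
Implicit Types x y : A.

Lemma namulNl x y : (- x) ** y = - (x ** y).
Proof. by rewrite -!scaleN1r namulZl. Qed.

Lemma namulNr x y : x ** (- y) = - (x ** y).
Proof. by rewrite -!scaleN1r namulZr. Qed.

Lemma namulBl x y z : (x - y) ** z = x ** z - y ** z.
Proof. by rewrite namulDl namulNl. Qed.

Lemma namulBr x y z : z ** (x - y) = z ** x - z ** y.
Proof. by rewrite namulDr namulNr. Qed.

End NonassocTheory.

(* Alt[V]: formal unital nonassociative expressions over V, modulo the
   congruence generated by the axioms of alternative F-algebras and the
   linearity of the inclusion of V. *)

Section FreeAlternative.
Variables (F : fieldType) (V : lmodType F).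

Inductive alt_term : Type :=
  | AVar of V
  | AZero
  | AOne
  | AAdd of alt_term & alt_term
  | AScale of F & alt_term
  | AMul of alt_term & alt_term.

Inductive alt_eq : alt_term -> alt_term -> Prop :=
  | aeq_refl s : alt_eq s s
  | aeq_sym s t : alt_eq s t -> alt_eq t s
  | aeq_trans s t u : alt_eq s t -> alt_eq t u -> alt_eq s u
  | aeq_add s s' t t' :
      alt_eq s s' -> alt_eq t t' -> alt_eq (AAdd s t) (AAdd s' t')
  | aeq_scale c s s' : alt_eq s s' -> alt_eq (AScale c s) (AScale c s')
  | aeq_mul s s' t t' :
      alt_eq s s' -> alt_eq t t' -> alt_eq (AMul s t) (AMul s' t')
  | aeq_addA s t u : alt_eq (AAdd s (AAdd t u)) (AAdd (AAdd s t) u)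
  | aeq_addC s t : alt_eq (AAdd s t) (AAdd t s)
  | aeq_add0 s : alt_eq (AAdd AZero s) s
  | aeq_addN s : alt_eq (AAdd (AScale (- 1) s) s) AZero
  | aeq_scaleA a b s : alt_eq (AScale a (AScale b s)) (AScale (a * b) s)
  | aeq_scale1 s : alt_eq (AScale 1 s) s
  | aeq_scaleDr a s t :
      alt_eq (AScale a (AAdd s t)) (AAdd (AScale a s) (AScale a t))
  | aeq_scaleDl a b s :
      alt_eq (AScale (a + b) s) (AAdd (AScale a s) (AScale b s))
  | aeq_mul1x s : alt_eq (AMul AOne s) s
  | aeq_mulx1 s : alt_eq (AMul s AOne) s
  | aeq_mulDl s t u : alt_eq (AMul (AAdd s t) u) (AAdd (AMul s u) (AMul t u))
  | aeq_mulDr s t u : alt_eq (AMul s (AAdd t u)) (AAdd (AMul s t) (AMul s u))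
  | aeq_mulZl c s t : alt_eq (AMul (AScale c s) t) (AScale c (AMul s t))
  | aeq_mulZr c s t : alt_eq (AMul s (AScale c t)) (AScale c (AMul s t))
  | aeq_alt_l s t : alt_eq (AMul s (AMul s t)) (AMul (AMul s s) t)
  | aeq_alt_r s t : alt_eq (AMul t (AMul s s)) (AMul (AMul t s) s)
  | aeq_varD u v : alt_eq (AVar (u + v)) (AAdd (AVar u) (AVar v))
  | aeq_varZ c v : alt_eq (AVar (c *: v)) (AScale c (AVar v)).

Definition alt_rel : rel {classic alt_term} := fun s t => `[< alt_eq s t >].

Lemma alt_rel_equiv : equiv_class_of alt_rel.
Proof.
split.
- by move=> s; apply/asboolP; exact: aeq_refl.
- by move=> s t; apply/idP/idP => /asboolP h; apply/asboolP; exact: aeq_sym.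
- move=> t s u /asboolP h1 /asboolP h2; apply/asboolP.
  exact: aeq_trans h1 h2.
Qed.

Canonical alt_rel_equivRel := EquivRelPack alt_rel_equiv.
Canonical alt_rel_encModRel := defaultEncModRel alt_rel.

Definition Alt : Type := {eq_quot alt_rel}.

HB.instance Definition _ : EqQuotient {classic alt_term} alt_rel Alt :=
  EqQuotient.on Alt.
HB.instance Definition _ := Choice.on Alt.

Definition alt_class (s : alt_term) : Alt := \pi_Alt (s : {classic alt_term}).

Lemma alt_classP s t : alt_class s = alt_class t <-> alt_eq s t.
Proof.
split=> [/eqP|h]; last first.
  by apply/eqP; rewrite /alt_class piE; apply/asboolP.
by rewrite /alt_class piE => /asboolP.
Qed.

Definition alt_repr (x : Alt) : alt_term := repr x.

Lemma alt_reprK x : alt_class (alt_repr x) = x.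
Proof. exact: reprK. Qed.

Lemma alt_repr_class s : alt_eq (alt_repr (alt_class s)) s.
Proof. by apply/alt_classP; rewrite alt_reprK. Qed.

Definition alt_zero : Alt := alt_class AZero.
Definition alt_one : Alt := alt_class AOne.
Definition alt_add (x y : Alt) := alt_class (AAdd (alt_repr x) (alt_repr y)).
Definition alt_scale (c : F) (x : Alt) := alt_class (AScale c (alt_repr x)).
Definition alt_opp (x : Alt) := alt_scale (- 1) x.
Definition alt_mul (x y : Alt) := alt_class (AMul (alt_repr x) (alt_repr y)).
Definition alt_var (v : V) : Alt := alt_class (AVar v).

Lemma alt_class_add s t :
  alt_class (AAdd s t) = alt_add (alt_class s) (alt_class t).
Proof. by apply/alt_classP/aeq_sym/aeq_add; exact: alt_repr_class. Qed.

Lemma alt_class_scale c s :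
  alt_class (AScale c s) = alt_scale c (alt_class s).
Proof. by apply/alt_classP/aeq_sym/aeq_scale; exact: alt_repr_class. Qed.

Lemma alt_class_mul s t :
  alt_class (AMul s t) = alt_mul (alt_class s) (alt_class t).
Proof. by apply/alt_classP/aeq_sym/aeq_mul; exact: alt_repr_class. Qed.

Definition alt_classE := (alt_class_add, alt_class_scale, alt_class_mul).

Lemma alt_addA : associative alt_add.
Proof.
move=> x y z; rewrite -[x]alt_reprK -[y]alt_reprK -[z]alt_reprK -!alt_classE.
exact/alt_classP/aeq_addA.
Qed.

Lemma alt_addC : commutative alt_add.
Proof.
move=> x y; rewrite -[x]alt_reprK -[y]alt_reprK -!alt_classE.
exact/alt_classP/aeq_addC.
Qed.

Lemma alt_add0 : left_id alt_zero alt_add.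
Proof.
by move=> x; rewrite -[x]alt_reprK -!alt_classE; exact/alt_classP/aeq_add0.
Qed.

Lemma alt_addN : left_inverse alt_zero alt_opp alt_add.
Proof.
move=> x; rewrite /alt_opp -[x]alt_reprK -!alt_classE.
exact/alt_classP/aeq_addN.
Qed.

HB.instance Definition _ :=
  GRing.isZmodule.Build Alt alt_addA alt_addC alt_add0 alt_addN.

Lemma alt_scaleA a b x : alt_scale a (alt_scale b x) = alt_scale (a * b) x.
Proof. by rewrite -[x]alt_reprK -!alt_classE; exact/alt_classP/aeq_scaleA. Qed.

Lemma alt_scale1 : left_id 1 alt_scale.
Proof.
by move=> x; rewrite -[x]alt_reprK -!alt_classE; exact/alt_classP/aeq_scale1.
Qed.

Lemma alt_scaleDr : right_distributive alt_scale +%R.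
Proof.
move=> a x y; rewrite /GRing.add /= -[x]alt_reprK -[y]alt_reprK -!alt_classE.
exact/alt_classP/aeq_scaleDr.
Qed.

Lemma alt_scaleDl x : {morph alt_scale^~ x : a b / a + b}.
Proof.
move=> a b; rewrite [RHS]/GRing.add /= -[x]alt_reprK -!alt_classE.
exact/alt_classP/aeq_scaleDl.
Qed.

HB.instance Definition _ := GRing.Zmodule_isLmodule.Build F Alt
  alt_scaleA alt_scale1 alt_scaleDr alt_scaleDl.

Lemma alt_mul1x : left_id alt_one alt_mul.
Proof.
by move=> x; rewrite -[x]alt_reprK -!alt_classE; exact/alt_classP/aeq_mul1x.
Qed.

Lemma alt_mulx1 : right_id alt_one alt_mul.
Proof.
by move=> x; rewrite -[x]alt_reprK -!alt_classE; exact/alt_classP/aeq_mulx1.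
Qed.

Lemma alt_mulDl : left_distributive alt_mul +%R.
Proof.
move=> x y z; rewrite /GRing.add /=.
rewrite -[x]alt_reprK -[y]alt_reprK -[z]alt_reprK -!alt_classE.
exact/alt_classP/aeq_mulDl.
Qed.

Lemma alt_mulDr : right_distributive alt_mul +%R.
Proof.
move=> x y z; rewrite /GRing.add /=.
rewrite -[x]alt_reprK -[y]alt_reprK -[z]alt_reprK -!alt_classE.
exact/alt_classP/aeq_mulDr.
Qed.

Lemma alt_mulZl c x y : alt_mul (c *: x) y = c *: alt_mul x y.
Proof.
rewrite /GRing.scale /= -[x]alt_reprK -[y]alt_reprK -!alt_classE.
exact/alt_classP/aeq_mulZl.
Qed.

Lemma alt_mulZr c x y : alt_mul x (c *: y) = c *: alt_mul x y.
Proof.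
rewrite /GRing.scale /= -[x]alt_reprK -[y]alt_reprK -!alt_classE.
exact/alt_classP/aeq_mulZr.
Qed.

HB.instance Definition _ := Lmodule_isNonassocAlgebra.Build F Alt
  alt_mul1x alt_mulx1 alt_mulDl alt_mulDr alt_mulZl alt_mulZr.

Lemma Alt_alternative : alternative Alt.
Proof.
split=> x y; rewrite /namul /= -[x]alt_reprK -[y]alt_reprK -!alt_classE.
  exact/alt_classP/aeq_alt_l.
exact/alt_classP/aeq_alt_r.
Qed.

Lemma alt_var_linear : linear alt_var.
Proof.
move=> c u v.
rewrite /GRing.scale [RHS]/GRing.add /= /alt_var -!alt_classE; apply/alt_classP.
apply: aeq_trans (aeq_varD _ _) _; apply: aeq_add; last exact: aeq_refl.
exact: aeq_varZ.
Qed.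

Section Universal.
Variables (A : nonassocAlgType F) (g : V -> A).

Fixpoint alt_eval (s : alt_term) : A :=
  match s with
  | AVar v => g v
  | AZero => 0
  | AOne => naone
  | AAdd s t => alt_eval s + alt_eval t
  | AScale c s => c *: alt_eval s
  | AMul s t => alt_eval s ** alt_eval t
  end.

Hypothesis altA : alternative A.
Hypothesis g_linear : linear g.

Lemma alt_eval_eq s t : alt_eq s t -> alt_eval s = alt_eval t.
Proof.
have gZ c v : g (c *: v) = c *: g v.
  have g0 : g 0 = 0.
    by have := g_linear (- 1) 0 0; rewrite scaleN1r addr0 oppr0 scaleN1r addNr.
  by have := g_linear c v 0; rewrite addr0 g0 addr0.
elim=> //= {s t}; do ?by move=> *; congruence.
- by move=> *; rewrite addrA.
- by move=> *; rewrite addrC.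
- by move=> *; rewrite add0r.
- by move=> *; rewrite scaleN1r addNr.
- by move=> *; rewrite scalerA.
- by move=> *; rewrite scale1r.
- by move=> *; rewrite scalerDr.
- by move=> *; rewrite scalerDl.
- by move=> *; rewrite namul1x.
- by move=> *; rewrite namulx1.
- by move=> *; rewrite namulDl.
- by move=> *; rewrite namulDr.
- by move=> *; rewrite namulZl.
- by move=> *; rewrite namulZr.
- by move=> *; rewrite altA.1.
- by move=> *; rewrite altA.2.
- by move=> u v; have := g_linear 1 u v; rewrite !scale1r.
Qed.

Lemma Alt_universal :
  exists f : Alt -> A,
    [/\ alg_morphism f,
        forall v, f (alt_var v) = g v
      & forall f' : Alt -> A, alg_morphism f' ->
          (forall v, f' (alt_var v) = g v) -> f' =1 f].
Proof.
pose f (x : Alt) := alt_eval (alt_repr x).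
have fE s : f (alt_class s) = alt_eval s.
  exact/alt_eval_eq/alt_repr_class.
exists f; split; first split.
- move=> c x y; rewrite /GRing.scale [in LHS]/GRing.add /=.
  by rewrite -[x]alt_reprK -[y]alt_reprK -!alt_classE !fE.
- exact: fE.
- move=> x y; rewrite [in LHS]/namul /=.
  by rewrite -[x]alt_reprK -[y]alt_reprK -!alt_classE !fE.
- by move=> v; rewrite fE.
move=> f' [f'l f'1 f'M] f'v x; rewrite -[x]alt_reprK fE.
have f'0 : f' 0 = 0.
  by have := f'l (- 1) 0 0; rewrite scaleN1r addr0 oppr0 scaleN1r addNr.
elim: (alt_repr x) => //= {x}.
- by move=> s IHs t IHt; rewrite alt_class_add -IHs -IHt -[f' (alt_class s)]scale1r
    -f'l scale1r.
- by move=> c s IHs; rewrite alt_class_scale -IHs -[RHS]addr0 -f'0 -f'l addr0.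
- by move=> s IHs t IHt; rewrite alt_class_mul -IHs -IHt -f'M.
Qed.

End Universal.
End FreeAlternative.

(* The square-zero extension F (+) V shows that F and V embed in Alt[V]. *)

Section Embedding.
Variables (F : fieldType) (V : lmodType F).

Definition null_ext : Type := (F^o * V)%type.

HB.instance Definition _ := GRing.Lmodule.copy null_ext (F^o * V)%type.

Definition null_one : null_ext := (1, 0).
Definition null_mul (x y : null_ext) : null_ext :=
  (x.1 * y.1, x.1 *: y.2 + y.1 *: x.2).

Lemma null_mulC : commutative null_mul.
Proof. by move=> x y; rewrite /null_mul mulrC addrC. Qed.

Lemma null_mulA : associative null_mul.
Proof.
move=> x y z; rewrite /null_mul /= mulrA; congr pair.
by rewrite !scalerDr !scalerA addrA mulrC [x.1 * z.1]mulrC [y.1 * z.1]mulrC.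
Qed.

Lemma null_mul1x : left_id null_one null_mul.
Proof.
by case=> a v; rewrite /null_mul /= mul1r scale1r scaler0 addr0.
Qed.

Lemma null_mulx1 : right_id null_one null_mul.
Proof. by move=> x; rewrite null_mulC null_mul1x. Qed.

Lemma null_mulDl : left_distributive null_mul +%R.
Proof.
move=> x y z; congr pair; rewrite /= ?mulrDl // scalerDl scalerDr.
by rewrite addrACA.
Qed.

Lemma null_mulDr : right_distributive null_mul +%R.
Proof. by move=> x y z; rewrite null_mulC null_mulDl !(null_mulC x). Qed.

Lemma null_mulZl (c : F) x y : null_mul (c *: x) y = c *: null_mul x y.
Proof.
congr pair; first by rewrite /= [c *: (_ : F^o)]/(c * _) -mulrA.
by rewrite /= scalerDr !scalerA [y.1 * c]mulrC.
Qed.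

Lemma null_mulZr (c : F) x y : null_mul x (c *: y) = c *: null_mul x y.
Proof. by rewrite null_mulC null_mulZl null_mulC. Qed.

HB.instance Definition _ := Lmodule_isNonassocAlgebra.Build F null_ext
  null_mul1x null_mulx1 null_mulDl null_mulDr null_mulZl null_mulZr.

Lemma Alt_embedding :
  injective (fun p : F * V => p.1 *: (naone : Alt V) + alt_var p.2).
Proof.
have alt_null : alternative null_ext.
  by split=> x y; rewrite /namul /= null_mulA.
have g_lin : linear (fun v : V => (0, v) : null_ext).
  by move=> c u v; congr pair; rewrite /= scaler0 addr0.
have [f [[fl f1 _] fv _]] := Alt_universal alt_null g_lin.
case=> [a u] [b v] /= /(congr1 f); rewrite !fl !f1 !fv => -[].
rewrite !addr0 !scaler0 !add0r => ab ->; congr pair.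
by move: ab; rewrite [LHS]mulr1 [RHS]mulr1.
Qed.

End Embedding.

HB.mixin Record isTwoSidedIdeal (F : fieldType) (A : nonassocAlgType F)
    (S : A -> bool) := {
  ideal_scale : forall (c : F) (x : A), S x -> S (c *: x);
  ideal_mull : forall x y : A, S y -> S (x ** y);
  ideal_mulr : forall x y : A, S x -> S (x ** y)
}.

#[short(type="nonassocIdeal")]
HB.structure Definition NonassocIdeal (F : fieldType) (A : nonassocAlgType F) :=
  {S of GRing.ZmodClosed A S & isTwoSidedIdeal F A S}.

(* A / I, on top of MathComp's quotient of a Z-module by a subgroup. *)

Section Quotient.
Variables (F : fieldType) (A : nonassocAlgType F) (I : nonassocIdeal A).

Definition alg_quot : Type := Quotient.quot I.

HB.instance Definition _ := GRing.Zmodule.on alg_quot.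

Definition quot_class (x : A) : alg_quot := \pi_(Quotient.quot I) x.
Definition quot_repr (x : alg_quot) : A := repr (x : Quotient.quot I).

Lemma quot_reprK x : quot_class (quot_repr x) = x.
Proof. exact: reprK. Qed.

Lemma quot_classP x y : quot_class x = quot_class y <-> x - y \in I.
Proof. by rewrite Quotient.idealrBE; split=> [h|/eqP//]; apply/eqP. Qed.

Lemma quot_class_add x y :
  quot_class (x + y) = quot_class x + quot_class y.
Proof. exact: Quotient.pi_add. Qed.

Lemma quot_repr_class x : quot_repr (quot_class x) - x \in I.
Proof. by apply/quot_classP; rewrite quot_reprK. Qed.

Definition quot_one : alg_quot := quot_class naone.
Definition quot_scale (c : F) (x : alg_quot) := quot_class (c *: quot_repr x).
Definition quot_mul (x y : alg_quot) := quot_class (quot_repr x ** quot_repr y).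

Lemma quot_class_scale c x :
  quot_class (c *: x) = quot_scale c (quot_class x).
Proof.
apply/esym/quot_classP; rewrite -scalerBr.
exact/ideal_scale/quot_repr_class.
Qed.

Lemma quot_class_mul x y :
  quot_class (x ** y) = quot_mul (quot_class x) (quot_class y).
Proof.
apply/esym/quot_classP.
set x' := quot_repr _; set y' := quot_repr _.
have -> : x' ** y' - x ** y = (x' - x) ** y' + x ** (y' - y).
  by rewrite namulBl namulBr addrA subrK.
apply: rpredD.
  exact/ideal_mulr/quot_repr_class.
exact/ideal_mull/quot_repr_class.
Qed.

Definition quot_classE := (quot_class_add, quot_class_scale, quot_class_mul).

Lemma quot_scaleA a b x : quot_scale a (quot_scale b x) = quot_scale (a * b) x.
Proof. by rewrite -[x]quot_reprK -!quot_classE scalerA. Qed.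

Lemma quot_scale1 : left_id 1 quot_scale.
Proof. by move=> x; rewrite -[x]quot_reprK -!quot_classE scale1r. Qed.

Lemma quot_scaleDr : right_distributive quot_scale +%R.
Proof.
by move=> a x y; rewrite -[x]quot_reprK -[y]quot_reprK -!quot_classE scalerDr.
Qed.

Lemma quot_scaleDl x : {morph quot_scale^~ x : a b / a + b}.
Proof. by move=> a b; rewrite -[x]quot_reprK -!quot_classE scalerDl. Qed.

HB.instance Definition _ := GRing.Zmodule_isLmodule.Build F alg_quot
  quot_scaleA quot_scale1 quot_scaleDr quot_scaleDl.

Lemma quot_mul1x : left_id quot_one quot_mul.
Proof. by move=> x; rewrite -[x]quot_reprK -!quot_classE namul1x. Qed.

Lemma quot_mulx1 : right_id quot_one quot_mul.
Proof. by move=> x; rewrite -[x]quot_reprK -!quot_classE namulx1. Qed.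

Lemma quot_mulDl : left_distributive quot_mul +%R.
Proof.
move=> x y z; rewrite -[x]quot_reprK -[y]quot_reprK -[z]quot_reprK.
by rewrite -!quot_classE namulDl.
Qed.

Lemma quot_mulDr : right_distributive quot_mul +%R.
Proof.
move=> x y z; rewrite -[x]quot_reprK -[y]quot_reprK -[z]quot_reprK.
by rewrite -!quot_classE namulDr.
Qed.

Lemma quot_mulZl c x y : quot_mul (c *: x) y = c *: quot_mul x y.
Proof.
rewrite /GRing.scale /= -[x]quot_reprK -[y]quot_reprK.
by rewrite -!quot_classE namulZl.
Qed.

Lemma quot_mulZr c x y : quot_mul x (c *: y) = c *: quot_mul x y.
Proof.
rewrite /GRing.scale /= -[x]quot_reprK -[y]quot_reprK.
by rewrite -!quot_classE namulZr.
Qed.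

HB.instance Definition _ := Lmodule_isNonassocAlgebra.Build F alg_quot
  quot_mul1x quot_mulx1 quot_mulDl quot_mulDr quot_mulZl quot_mulZr.

Lemma quot_class_morphism : alg_morphism quot_class.
Proof.
by split=> // [c x y|x y]; rewrite !quot_classE.
Qed.

End Quotient.

Section GeneratedIdeal.
Variables (F : fieldType) (A : nonassocAlgType F) (S : A -> Prop).

Inductive in_ideal_gen : A -> Prop :=
  | ideal_gen_base x : S x -> in_ideal_gen x
  | ideal_gen_zero : in_ideal_gen 0
  | ideal_gen_add x y :
      in_ideal_gen x -> in_ideal_gen y -> in_ideal_gen (x + y)
  | ideal_gen_scale c x : in_ideal_gen x -> in_ideal_gen (c *: x)
  | ideal_gen_mull x y : in_ideal_gen y -> in_ideal_gen (x ** y)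
  | ideal_gen_mulr x y : in_ideal_gen x -> in_ideal_gen (x ** y).

Definition ideal_gen (x : A) : bool := `[< in_ideal_gen x >].

Lemma ideal_gen_zmod_closed : zmod_closed ideal_gen.
Proof.
split; first exact/asboolP/ideal_gen_zero.
move=> x y /asboolP xI /asboolP yI; apply/asboolP/ideal_gen_add => //.
by rewrite -scaleN1r; exact: ideal_gen_scale.
Qed.

HB.instance Definition _ :=
  GRing.isZmodClosed.Build A ideal_gen ideal_gen_zmod_closed.

Lemma ideal_genZ (c : F) x : ideal_gen x -> ideal_gen (c *: x).
Proof. by move=> /asboolP xI; exact/asboolP/ideal_gen_scale. Qed.

Lemma ideal_genMl x y : ideal_gen y -> ideal_gen (x ** y).
Proof. by move=> /asboolP yI; exact/asboolP/ideal_gen_mull. Qed.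

Lemma ideal_genMr x y : ideal_gen x -> ideal_gen (x ** y).
Proof. by move=> /asboolP xI; exact/asboolP/ideal_gen_mulr. Qed.

HB.instance Definition _ := isTwoSidedIdeal.Build F A ideal_gen
  ideal_genZ ideal_genMl ideal_genMr.

End GeneratedIdeal.

Section Kingdon.
Variables (F : fieldType) (V : vectType F) (B : {symmetric V}).

Local Notation "` v" := (alt_var v) (at level 5, format "` v").

Inductive kingdon_relator : Alt V -> Prop :=
  | kingdon_anticomm (u v : V) :
      kingdon_relator (`u ** `v + `v ** `u - B u v *: naone)
  | kingdon_reverse (u v w : V) :
      kingdon_relator ((`u ** `v) ** `w - `w ** (`v ** `u)).

Definition kingdon_ideal : nonassocIdeal (Alt V) :=
  NonassocIdeal.clone F (Alt V) (ideal_gen kingdon_relator) _.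

Definition Kingdon : nonassocAlgType F := alg_quot kingdon_ideal.

End Kingdon.

Section ZeroForm.
Variables (F : fieldType) (V : lmodType F).

Definition zero_form (u v : V) : F := 0.

Lemma zero_form_linear_l (v : V) : linear_for *%R (zero_form^~ v).
Proof. by move=> c x y; rewrite /zero_form mulr0 addr0. Qed.

Lemma zero_form_linear_r (u : V) : linear_for (idfun \; *%R) (zero_form u).
Proof. by move=> c x y; rewrite /zero_form /= mulr0 addr0. Qed.

HB.instance Definition _ := bilinear_isBilinear.Build F V V F
  *%R (idfun \; *%R) zero_form (zero_form_linear_l, zero_form_linear_r).

Lemma zero_form_symmetric (u v : V) :
  zero_form u v = (-1) ^+ false * idfun (zero_form v u).
Proof. by rewrite /zero_form /= mulr0. Qed.

HB.instance Definition _ := isHermitianSesquilinear.Build F V false idfun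
  zero_form zero_form_symmetric.

End ZeroForm.

Inductive lambda_basis : Set := L1 | Li | Lj | Lk | Lij | Ljk | Lki | Lomega.

Definition lambda_basis_code (b : lambda_basis) : 'I_8 :=
  match b with
  | L1 => inord 0 | Li => inord 1 | Lj => inord 2 | Lk => inord 3
  | Lij => inord 4 | Ljk => inord 5 | Lki => inord 6 | Lomega => inord 7
  end.

Definition lambda_basis_decode (n : 'I_8) : lambda_basis :=
  nth L1 [:: L1; Li; Lj; Lk; Lij; Ljk; Lki; Lomega] n.

Lemma lambda_basis_codeK : cancel lambda_basis_code lambda_basis_decode.
Proof. by case; rewrite /lambda_basis_decode /= inordK. Qed.

HB.instance Definition _ := Finite.copy lambda_basis
  (can_type lambda_basis_codeK).

Section AltExterior.
Variable F : fieldType.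

Definition Lambda' : Type := {ffun lambda_basis -> F^o}.

HB.instance Definition _ :=
  GRing.Lmodule.copy Lambda' {ffun lambda_basis -> F^o}.

Definition lambda_elt (b : lambda_basis) : Lambda' := [ffun c => (c == b)%:R].

Definition lambda_basis_mul (a b : lambda_basis) : Lambda' :=
  match a, b with
  | L1, c | c, L1 => lambda_elt c
  | Li, Lj => lambda_elt Lij
  | Lj, Li => - lambda_elt Lij
  | Lj, Lk => lambda_elt Ljk
  | Lk, Lj => - lambda_elt Ljk
  | Lk, Li => lambda_elt Lki
  | Li, Lk => - lambda_elt Lki
  | Lij, Lk | Ljk, Li | Lki, Lj => lambda_elt Lomega
  | Lk, Lij | Li, Ljk | Lj, Lki => - lambda_elt Lomega
  | _, _ => 0
  end.

Definition lambda_mul (x y : Lambda') : Lambda' :=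
  \sum_a \sum_b (x a * y b) *: lambda_basis_mul a b.

Lemma lambda_mulDl : left_distributive lambda_mul +%R.
Proof.
move=> x y z; rewrite /lambda_mul -big_split; apply: eq_bigr => a _.
by rewrite -big_split; apply: eq_bigr => b _; rewrite /= ffunE mulrDl scalerDl.
Qed.

Lemma lambda_mulDr : right_distributive lambda_mul +%R.
Proof.
move=> x y z; rewrite /lambda_mul -big_split; apply: eq_bigr => a _.
by rewrite -big_split; apply: eq_bigr => b _; rewrite /= ffunE mulrDr scalerDl.
Qed.

Lemma lambda_mulZl (c : F) x y : lambda_mul (c *: x) y = c *: lambda_mul x y.
Proof.
rewrite /lambda_mul scaler_sumr; apply: eq_bigr => a _.
rewrite scaler_sumr; apply: eq_bigr => b _.
by rewrite /= ffunE -mulrA scalerA.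
Qed.

Lemma lambda_mulZr (c : F) x y : lambda_mul x (c *: y) = c *: lambda_mul x y.
Proof.
rewrite /lambda_mul scaler_sumr; apply: eq_bigr => a _.
rewrite scaler_sumr; apply: eq_bigr => b _.
by rewrite /= ffunE mulrCA scalerA.
Qed.

Lemma lambda_sum_elt (x : Lambda') : x = \sum_a x a *: lambda_elt a.
Proof.
apply/ffunP => c; rewrite sum_ffunE (bigD1 c) //= big1 => [|a ac].
  by rewrite !ffunE eqxx addr0 -[LHS]mulr1.
by rewrite !ffunE eq_sym (negPf ac); exact: mulr0.
Qed.

Lemma lambda_mul_elt a b :
  lambda_mul (lambda_elt a) (lambda_elt b) = lambda_basis_mul a b.
Proof.
rewrite /lambda_mul (bigD1 a) //= [X in _ + X]big1 ?addr0 => [|a' na].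
  rewrite (bigD1 b) //= big1 ?addr0 => [|b' nb].
    by rewrite !ffunE !eqxx mulr1 scale1r.
  by rewrite !ffunE (negPf nb) mulr0 scale0r.
by apply: big1 => b' _; rewrite !ffunE (negPf na) mul0r scale0r.
Qed.

Lemma lambda_mul1x : left_id (lambda_elt L1) lambda_mul.
Proof.
move=> x; rewrite [RHS]lambda_sum_elt /lambda_mul (bigD1 L1) //=.
rewrite [X in _ + X]big1 ?addr0 => [|a na].
  by apply: eq_bigr => b _; rewrite ffunE eqxx mul1r.
by apply: big1 => b _; rewrite ffunE (negPf na) mul0r scale0r.
Qed.

Lemma lambda_mulx1 : right_id (lambda_elt L1) lambda_mul.
Proof.
move=> x; rewrite [RHS]lambda_sum_elt /lambda_mul.
apply: eq_bigr => a _; rewrite (bigD1 L1) //= big1 ?addr0 => [|b nb].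
  by rewrite ffunE eqxx mulr1; case: a.
by rewrite ffunE (negPf nb) mulr0 scale0r.
Qed.

HB.instance Definition _ := Lmodule_isNonassocAlgebra.Build F Lambda'
  lambda_mul1x lambda_mulx1 lambda_mulDl lambda_mulDr lambda_mulZl lambda_mulZr.

End AltExterior.

(* Main.v *)
(** In an alternative algebra the left (resp. right) multiplications by
    pairwise anticommuting square-zero elements [e u] anticommute and square
    to zero. Reversal makes [e u] anticommute with products of two generators,
    so the associator [(e u, e v, e w)] is
    [(e u ** e v) ** e w + (e v ** e w) ** e u]; as associators are invariant
    under cyclic permutation, so are the products [(e u ** e v) ** e w]. With
    three generators, products of degree at least 4 contain a repeated
    generator, which can be moved next to its double, so they vanish. Hence
    the generators of the Kingdon algebra satisfy the multiplication table of
    [Lambda'], which gives a morphism from [Lambda'] to it; its inverse comes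
    from the universal property, [Lambda'] being alternative. *)
Require Import Defs.
From mathcomp Require Import all_boot all_order all_algebra.
From mathcomp Require Import boolp ring zify.

Set Implicit Arguments.
Unset Strict Implicit.
Unset Printing Implicit Defensive.

Import GRing.Theory.
Local Open Scope ring_scope.
Local Open Scope nonassoc_scope.

(** * Sums and morphisms in nonassociative algebras *)

Section NonassocZero.
Variables (F : fieldType) (A : nonassocAlgType F).

Lemma namul0x (x : A) : 0 ** x = 0.
Proof. by rewrite -[0](scale0r (0 : A)) namulZl !scale0r. Qed.

Lemma namulx0 (x : A) : x ** 0 = 0.
Proof. by rewrite -[0](scale0r (0 : A)) namulZr !scale0r. Qed.

Lemma namul_suml (I : finType) (f : I -> A) (y : A) :
  (\sum_i f i) ** y = \sum_i f i ** y.
Proof.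
by apply: (big_morph (namul^~ y)) => [u v|]; rewrite ?namulDl ?namul0x.
Qed.

Lemma namul_sumr (I : finType) (x : A) (f : I -> A) :
  x ** (\sum_i f i) = \sum_i x ** f i.
Proof.
by apply: (big_morph (namul x)) => [u v|]; rewrite ?namulDr ?namulx0.
Qed.

End NonassocZero.

Section AlgMorphism.
Variables (F : fieldType) (A B C : nonassocAlgType F).

Lemma alg_morphism_comp (g : B -> C) (f : A -> B) :
  alg_morphism g -> alg_morphism f -> alg_morphism (g \o f).
Proof.
move=> [gl g1 gM] [fl f1 fM].
split=> [c x y||x y] /=; first by rewrite fl gl.
  by rewrite f1 g1.
by rewrite fM gM.
Qed.

Variable f : A -> B.
Hypothesis fP : alg_morphism f.

Let fl : linear f. Proof. by case: fP. Qed.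

Lemma alg_morphD x y : f (x + y) = f x + f y.
Proof. by have := fl 1 x y; rewrite !scale1r. Qed.

Lemma alg_morph0 : f 0 = 0.
Proof. by have := fl (-1) 0 0; rewrite scaler0 addr0 scaleN1r addNr. Qed.

Lemma alg_morphZ c x : f (c *: x) = c *: f x.
Proof. by have := fl c x 0; rewrite alg_morph0 !addr0. Qed.

Lemma alg_morphB x y : f (x - y) = f x - f y.
Proof. by rewrite alg_morphD -!scaleN1r alg_morphZ. Qed.

Lemma alg_morph_sum (I : finType) (h : I -> A) :
  f (\sum_i h i) = \sum_i f (h i).
Proof. by apply: (big_morph f); [exact: alg_morphD | exact: alg_morph0]. Qed.

End AlgMorphism.

(** * Quotients and generated ideals *)

Lemma alg_quot_alternative (F : fieldType) (A : nonassocAlgType F)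
    (I : nonassocIdeal A) :
  alternative A -> alternative (alg_quot I).
Proof.
move=> [altl altr]; have [_ _ qM] := quot_class_morphism I.
split=> x y; rewrite -[x]quot_reprK -[y]quot_reprK.
  have := congr1 (quot_class I) (altl (quot_repr x) (quot_repr y)).
  by rewrite !qM.
have := congr1 (quot_class I) (altr (quot_repr x) (quot_repr y)).
by rewrite !qM.
Qed.

(** The kernel of a morphism is a two-sided ideal, so checking generators suffices. *)
Lemma alg_morph_ideal_gen (F : fieldType) (A B : nonassocAlgType F)
    (S : A -> Prop) (f : A -> B) :
    alg_morphism f -> (forall x, S x -> f x = 0) ->
  forall x, ideal_gen S x -> f x = 0.
Proof.
move=> fP fS x /asboolP; have [fl f1 fM] := fP.
elim=> {x} [x Sx||x y _ fx _ fy|c x _ fx|x y _ fy|x y _ fx].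
- exact: fS.
- exact: alg_morph0.
- by rewrite (alg_morphD fP) fx fy addr0.
- by rewrite (alg_morphZ fP) fx scaler0.
- by rewrite fM fy namulx0.
- by rewrite fM fx namul0x.
Qed.

Lemma alg_quot_lift (F : fieldType) (A B : nonassocAlgType F)
    (I : nonassocIdeal A) (f : A -> B) :
    alg_morphism f -> (forall x, x \in I -> f x = 0) ->
  exists2 g : alg_quot I -> B,
    alg_morphism g & forall x, g (quot_class I x) = f x.
Proof.
move=> fP fI; have [fl f1 fM] := fP.
(* The chosen representative differs from [x] by an element of [I], which [f] kills. *)
have gE x : f (quot_repr (quot_class I x)) = f x.
  apply/eqP; rewrite -subr_eq0 -(alg_morphB fP); apply/eqP/fI.
  exact: quot_repr_class.
have [ql q1 qM] := quot_class_morphism I.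
exists (fun x => f (quot_repr x)) => //; split=> [c x y||x y].
- by rewrite -fl -[RHS]gE ql !quot_reprK.
- by rewrite -q1 gE f1.
- by rewrite -fM -[RHS]gE qM !quot_reprK.
Qed.

(** * Linearized alternative laws and the alternating associator *)

Section LinearizedAlternative.
Variables (F : fieldType) (A : nonassocAlgType F).
Hypothesis altA : alternative A.
Implicit Types x y z : A.

Definition associator x y z : A := (x ** y) ** z - x ** (y ** z).

(** Polarization: the left alternative law at [x + y], minus the laws at [x] and at [y]. *)
Lemma alt_linear_l x y z :
  x ** (y ** z) + y ** (x ** z) = (x ** y + y ** x) ** z.
Proof.
have := altA.1 (x + y) z.
rewrite !(namulDl, namulDr) !altA.1 -!addrA => /addrI.
by rewrite !addrA => /addIr ->.
Qed.

Lemma alt_linear_r x y z :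
  (x ** y) ** z + (x ** z) ** y = x ** (y ** z + z ** y).
Proof.
have := altA.2 (y + z) x.
rewrite !(namulDl, namulDr) !altA.2 -!addrA => /addrI.
by rewrite !addrA => /addIr ->; rewrite addrC.
Qed.

Lemma associatorCl x y z : associator y x z = - associator x y z.
Proof.
apply/eqP; rewrite -addr_eq0 /associator addrACA -opprD -namulDl.
by rewrite alt_linear_l subrr.
Qed.

Lemma associatorCr x y z : associator x z y = - associator x y z.
Proof.
apply/eqP; rewrite -addr_eq0 /associator addrACA -opprD -namulDr.
by rewrite alt_linear_r subrr.
Qed.

Lemma associator_cycle x y z : associator y z x = associator x y z.
Proof. by rewrite associatorCr associatorCl opprK. Qed.

End LinearizedAlternative.

(** * Products of anticommuting generators *)

Section KingdonGenerators.
Variables (F : fieldType) (A : nonassocAlgType F) (I : Type) (e : I -> A).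
Hypothesis two_unit : (2 : F) \is a GRing.unit.
Hypothesis altA : alternative A.
Hypothesis e_anti : forall u v, e u ** e v + e v ** e u = 0.
Hypothesis e_rev : forall u v w, (e u ** e v) ** e w = e w ** (e v ** e u).
Implicit Types u v w : I.

Lemma gen_anti u v : e v ** e u = - (e u ** e v).
Proof. by apply/eqP; rewrite -addr_eq0 e_anti. Qed.

(** Anticommutation of [e u] with itself only gives twice the square; this is where 2 must be
    invertible. *)
Lemma gen_sq u : e u ** e u = 0.
Proof.
have := e_anti u u; rewrite -mulr2n -scaler_nat => /(congr1 (GRing.scale 2^-1)).
by rewrite scalerA mulVr // scale1r scaler0.
Qed.

Lemma gen_mul2C u v w : e w ** (e u ** e v) = - ((e u ** e v) ** e w).
Proof. by rewrite e_rev [e v ** _]gen_anti namulNr opprK. Qed.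

Lemma gen_mull_sq u (x : A) : e u ** (e u ** x) = 0.
Proof. by rewrite altA.1 gen_sq namul0x. Qed.

Lemma gen_mulr_sq u (x : A) : (x ** e u) ** e u = 0.
Proof. by rewrite -altA.2 gen_sq namulx0. Qed.

Lemma gen_mul3_cycle u v w :
  (e v ** e w) ** e u = (e u ** e v) ** e w.
Proof.
have assocE a b c : associator (e a) (e b) (e c)
    = (e a ** e b) ** e c + (e b ** e c) ** e a.
  by rewrite /associator gen_mul2C opprK.
(* By [assocE], both associators contain the summand [(e w ** e u) ** e v]; cancelling it leaves the
   claim. *)
have : associator (e v) (e w) (e u) = associator (e w) (e u) (e v).
  exact/esym/associator_cycle.
by rewrite !assocE [LHS]addrC => /addrI.
Qed.

Lemma gen_mul3_repeat u w : (e u ** e w) ** e u = 0.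
Proof. by rewrite -gen_mul3_cycle gen_mulr_sq. Qed.

Lemma gen_mul_gen3_repeat u v w : e u ** ((e u ** e v) ** e w) = 0.
Proof. by rewrite -gen_mul3_cycle e_rev gen_mull_sq. Qed.

Lemma gen3_mul_gen_repeat u v w : ((e u ** e v) ** e w) ** e u = 0.
Proof. by rewrite -gen_mul3_cycle gen_mulr_sq. Qed.

(** Pigeonhole form of the condition that [I] has at most three elements. *)
Hypothesis I_le3 : forall x u v w : I,
  [\/ x = u, x = v, x = w | [\/ u = v, v = w | w = u]].

(** If [x] is the repeated index, a cyclic rotation brings its double to the front; otherwise the
    degree 3 factor already vanishes. *)
Lemma gen_mul_gen3 x u v w : e x ** ((e u ** e v) ** e w) = 0.
Proof.
case: (I_le3 x u v w) => [->|->|->|[->|->|->]].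
- exact: gen_mul_gen3_repeat.
- by rewrite -gen_mul3_cycle gen_mul_gen3_repeat.
- by rewrite gen_mul3_cycle gen_mul_gen3_repeat.
- by rewrite gen_sq namul0x namulx0.
- by rewrite gen_mulr_sq namulx0.
- by rewrite gen_mul3_repeat namulx0.
Qed.

Lemma gen3_mul_gen x u v w : ((e u ** e v) ** e w) ** e x = 0.
Proof.
case: (I_le3 x u v w) => [->|->|->|[->|->|->]].
- exact: gen3_mul_gen_repeat.
- by rewrite -gen_mul3_cycle gen3_mul_gen_repeat.
- exact: gen_mulr_sq.
- by rewrite gen_sq !namul0x.
- by rewrite gen_mulr_sq namul0x.
- by rewrite gen_mul3_repeat namul0x.
Qed.

(** [e w] anticommutes with [e u ** e v], so by linearized alternativity their left multiplications
    anticommute too. *)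
Lemma gen2_mul_genl u v w (x : A) :
  (e u ** e v) ** (e w ** x) = - (e w ** ((e u ** e v) ** x)).
Proof.
apply/eqP; rewrite -addr_eq0 (alt_linear_l altA).
by rewrite gen_mul2C subrr namul0x.
Qed.

Lemma genr_mul_gen2 u v w (x : A) :
  (x ** e w) ** (e u ** e v) = - ((x ** (e u ** e v)) ** e w).
Proof.
apply/eqP; rewrite -addr_eq0 (alt_linear_r altA).
by rewrite gen_mul2C addNr namulx0.
Qed.

Lemma gen2_mul_gen2 u v w x : (e u ** e v) ** (e w ** e x) = 0.
Proof. by rewrite gen2_mul_genl gen_mul_gen3 oppr0. Qed.

Lemma gen2_mul_gen3 u v x y z :
  (e u ** e v) ** ((e x ** e y) ** e z) = 0.
(* Reversal puts a generator in front of the degree 3 factor, past which the degree 2 factor can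
   move. *)
Proof. by rewrite e_rev gen2_mul_genl gen2_mul_gen2 namulx0 oppr0. Qed.

Lemma gen3_mul_gen2 u v x y z :
  ((e x ** e y) ** e z) ** (e u ** e v) = 0.
Proof. by rewrite genr_mul_gen2 gen2_mul_gen2 namul0x oppr0. Qed.

Lemma gen3_mul_gen3 u v w x y z :
  ((e u ** e v) ** e w) ** ((e x ** e y) ** e z) = 0.
Proof.
(* The desired product is one of the four terms of this identity; the other three vanish by the
   lemmas for smaller degrees. *)
have := alt_linear_l altA ((e u ** e v) ** e w) (e x ** e y) (e z).
by rewrite gen3_mul_gen gen3_mul_gen2 gen2_mul_gen3 namulx0 !addr0 namul0x.
Qed.

End KingdonGenerators.

Lemma ord3_pigeonhole (x u v w : 'I_3) :
  [\/ x = u, x = v, x = w | [\/ u = v, v = w | w = u]].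
Proof.
have : [|| x == u, x == v, x == w | [|| u == v, v == w | w == u]].
  case: x u v w => [x hx] [u hu] [v hv] [w hw].
  rewrite -!val_eqE /=; lia.
case/or4P => [/eqP ?|/eqP ?|/eqP ?|h]; first exact: Or41.
- exact: Or42.
- exact: Or43.
by apply: Or44; case/or3P: h => /eqP ?; [exact: Or31|exact: Or32|exact: Or33].
Qed.

(** * The morphism out of [Lambda'] given by three generators *)

Section LambdaUniversal.
Variables (F : fieldType) (A : nonassocAlgType F) (e : 'I_3 -> A).
Hypothesis two_unit : (2 : F) \is a GRing.unit.
Hypothesis altA : alternative A.
Hypothesis e_anti : forall u v, e u ** e v + e v ** e u = 0.
Hypothesis e_rev : forall u v w, (e u ** e v) ** e w = e w ** (e v ** e u).

Let i : 'I_3 := inord 0.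
Let j : 'I_3 := inord 1.
Let k : 'I_3 := inord 2.

Definition lambda_gen_image (b : lambda_basis) : A :=
  match b with
  | L1 => naone | Li => e i | Lj => e j | Lk => e k
  | Lij => e i ** e j | Ljk => e j ** e k | Lki => e k ** e i
  | Lomega => (e i ** e j) ** e k
  end.

Definition lambda_ext (x : Lambda' F) : A :=
  \sum_b (x b : F) *: lambda_gen_image b.

Lemma lambda_ext_linear : linear lambda_ext.
Proof.
move=> c x y; rewrite /lambda_ext scaler_sumr -big_split; apply: eq_bigr => b _.
by rewrite !ffunE scalerDl scalerA.
Qed.

Lemma lambda_ext_elt b : lambda_ext (lambda_elt F b) = lambda_gen_image b.
Proof.
rewrite /lambda_ext (bigD1 b) //= big1 => [|a ab].
  by rewrite ffunE eqxx scale1r addr0.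
by rewrite ffunE (negPf ab) scale0r.
Qed.

Lemma lambda_ext_morphism : alg_morphism lambda_ext.
Proof.
have extD x y : lambda_ext (x + y) = lambda_ext x + lambda_ext y.
  by have := lambda_ext_linear 1 x y; rewrite !scale1r.
have ext0 : lambda_ext 0 = 0.
  by rewrite /lambda_ext big1 // => b _; rewrite ffunE scale0r.
have extZ c x : lambda_ext (c *: x) = c *: lambda_ext x.
  by have := lambda_ext_linear c x 0; rewrite ext0 !addr0.
have extN x : lambda_ext (- x) = - lambda_ext x.
  by rewrite -!scaleN1r extZ.
(* By bilinearity, multiplicativity only has to be checked on the 64 pairs of basis elements. *)
have ext_basis a b : lambda_ext (lambda_basis_mul F a b)
    = lambda_gen_image a ** lambda_gen_image b.
  have jki : (e j ** e k) ** e i = (e i ** e j) ** e k.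
    exact: gen_mul3_cycle.
  have kij : (e k ** e i) ** e j = (e i ** e j) ** e k.
    by rewrite -jki; exact: gen_mul3_cycle.
  have le3 := ord3_pigeonhole.
  (* Anticommutation is oriented towards the basis products [ij], [jk] and [ki]. *)
  have deg2 := (gen_sq two_unit e_anti, gen_anti e_anti i j,
    gen_anti e_anti j k, gen_anti e_anti k i).
  have deg3 := (gen_mul2C e_anti e_rev,
    gen_mul3_repeat two_unit altA e_anti e_rev,
    gen_mulr_sq two_unit altA e_anti, jki, kij).
  have deg4 := (gen_mul_gen3 two_unit altA e_anti e_rev le3,
    gen3_mul_gen two_unit altA e_anti e_rev le3,
    gen2_mul_gen2 two_unit altA e_anti e_rev le3).
  have deg5 := (gen2_mul_gen3 two_unit altA e_anti e_rev le3,
    gen3_mul_gen2 two_unit altA e_anti e_rev le3,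
    gen3_mul_gen3 two_unit altA e_anti e_rev le3).
  by case: a; case: b; rewrite /= ?extN ?ext0 ?lambda_ext_elt /=
    ?namul1x ?namulx1 // ?(deg5, deg4) // ?deg3 ?deg2 ?oppr0.
split; first exact: lambda_ext_linear.
  exact: lambda_ext_elt.
move=> x y; rewrite [in LHS]/namul /= /lambda_mul.
rewrite (big_morph lambda_ext extD ext0) /lambda_ext namul_suml.
apply: eq_bigr => a _; rewrite namul_sumr.
rewrite -[LHS]/(lambda_ext _) (big_morph lambda_ext extD ext0).
apply: eq_bigr => b _.
by rewrite extZ ext_basis namulZl namulZr scalerA.
Qed.

End LambdaUniversal.

(** * Coordinates in [Lambda'] and its alternativity *)

Lemma lambda_basis_sum (R : nmodType) (f : lambda_basis -> R) :
  \sum_b f b = f L1 + f Li + f Lj + f Lk + f Lij + f Ljk + f Lki + f Lomega.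
Proof.
pose s := [:: L1; Li; Lj; Lk; Lij; Ljk; Lki; Lomega].
have s_uniq : uniq s.
  rewrite /= !inE !negb_or; do ?[apply/andP; split] => //; exact/eqP.
rewrite (perm_big s) /= => [|].
  by rewrite !big_cons big_nil addr0 !addrA.
apply: uniq_perm => //; first exact: index_enum_uniq.
by move=> b; rewrite mem_index_enum; case: b; rewrite !inE eqxx ?orbT.
Qed.

(* The decidable equality of [lambda_basis] goes through [inord], which blocks
   computation. *)
Definition lambda_basis_eq (a b : lambda_basis) : bool :=
  match a, b with
  | L1, L1 | Li, Li | Lj, Lj | Lk, Lk => true
  | Lij, Lij | Ljk, Ljk | Lki, Lki | Lomega, Lomega => true
  | _, _ => false
  end.

Lemma lambda_basis_eqE (a b : lambda_basis) : (a == b) = lambda_basis_eq a b.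
Proof. by apply/eqP/idP; case: a; case: b. Qed.

(** The multiplication table as explicit polynomials, so that identities in [Lambda'] become
    coordinatewise goals for [ring]. *)
Definition lambda_coord (F : fieldType) (x y : lambda_basis -> F) c : F :=
  match c with
  | L1 => x L1 * y L1
  | Li => x L1 * y Li + x Li * y L1
  | Lj => x L1 * y Lj + x Lj * y L1
  | Lk => x L1 * y Lk + x Lk * y L1
  | Lij => x L1 * y Lij + x Lij * y L1 + x Li * y Lj - x Lj * y Li
  | Ljk => x L1 * y Ljk + x Ljk * y L1 + x Lj * y Lk - x Lk * y Lj
  | Lki => x L1 * y Lki + x Lki * y L1 + x Lk * y Li - x Li * y Lk
  | Lomega => x L1 * y Lomega + x Lomega * y L1
      + x Lij * y Lk + x Ljk * y Li + x Lki * y Lj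
      - x Lk * y Lij - x Li * y Ljk - x Lj * y Lki
  end.

Lemma lambda_mul_coord (F : fieldType) (x y : Lambda' F) c :
  (x ** y) c = lambda_coord x y c.
Proof.
have NE (z : Lambda' F) : (- z) c = - z c by rewrite ffunE.
have zE : (0 : Lambda' F) c = 0 by rewrite ffunE.
have eltE b : lambda_elt F b c = (lambda_basis_eq c b)%:R.
  by rewrite ffunE lambda_basis_eqE.
have -> : (x ** y) c = \sum_a \sum_b x a * y b * lambda_basis_mul F a b c.
  rewrite [in LHS]/namul /= /lambda_mul sum_ffunE; apply: eq_bigr => a _.
  by rewrite sum_ffunE; apply: eq_bigr => b _; rewrite ffunE.
rewrite !lambda_basis_sum /lambda_basis_mul !NE !eltE zE.
by case: c {NE eltE zE} => /=; ring.
Qed.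

Lemma Lambda'_alternative (F : fieldType) : alternative (Lambda' F).
Proof.
split=> x y; apply/ffunP => c; rewrite !lambda_mul_coord.
  by case: c => /=; rewrite !lambda_mul_coord /=; ring.
by case: c => /=; rewrite !lambda_mul_coord /=; ring.
Qed.

(** * The Kingdon relations for vectors inside [Lambda'] *)

Definition lambda_vec (F : fieldType) (v : 'rV[F]_3) : Lambda' F :=
  [ffun b => match b with
     | Li => v 0 (inord 0) | Lj => v 0 (inord 1) | Lk => v 0 (inord 2) | _ => 0
   end].

Lemma lambda_vec_linear (F : fieldType) : linear (@lambda_vec F).
Proof.
move=> c u v; apply/ffunP => b; rewrite !ffunE.
by case: b; rewrite ?mxE //= ?[_ *: _]mulr0 addr0.
Qed.

Lemma lambda_vec_anticomm (F : fieldType) (u v : 'rV[F]_3) :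
  lambda_vec u ** lambda_vec v + lambda_vec v ** lambda_vec u = 0.
Proof.
apply/ffunP => c; rewrite !ffunE !lambda_mul_coord.
by case: c; rewrite /= !ffunE /=; ring.
Qed.

Lemma lambda_vec_reverse (F : fieldType) (u v w : 'rV[F]_3) :
  (lambda_vec u ** lambda_vec v) ** lambda_vec w
    = lambda_vec w ** (lambda_vec v ** lambda_vec u).
Proof.
apply/ffunP => c; rewrite !lambda_mul_coord.
by case: c; rewrite /= !lambda_mul_coord /= !ffunE /=; ring.
Qed.

(** The default [Li] of [nth] is never reached, as [n < 3]. *)
Lemma lambda_vec_delta (F : fieldType) (n : nat) (lt3 : (n < 3)%N) :
  lambda_vec (delta_mx 0 (inord n) : 'rV[F]_3)
    = lambda_elt F (nth Li [:: Li; Lj; Lk] n).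
Proof.
apply/ffunP => b; rewrite !ffunE lambda_basis_eqE !mxE -!val_eqE /= !inordK //.
by case: n lt3 => [|[|[|]]] //; case: b.
Qed.

(** * The Kingdon algebra of the zero form *)

Section KingdonZero.
Variables (F : fieldType) (V : vectType F).

Local Notation K := (Kingdon (@zero_form F V)).
Local Notation kclass :=
  (quot_class (kingdon_ideal (@zero_form F V))).

Definition kingdon_vec (v : V) : K := kclass (alt_var v).

Lemma kclass_morphism : @alg_morphism F _ K kclass.
Proof. exact: quot_class_morphism. Qed.

Lemma kingdon_vec_linear : linear kingdon_vec.
Proof.
have [ql _ _] := kclass_morphism.
by move=> c u v; rewrite /kingdon_vec alt_var_linear ql.
Qed.

Lemma kclass_relator (x : Alt V) :
  kingdon_relator (@zero_form F V) x -> kclass x = 0 :> K.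
Proof.
move=> xR; rewrite -(alg_morph0 kclass_morphism); apply/quot_classP.
rewrite subr0; exact/asboolP/ideal_gen_base.
Qed.

Lemma kingdon_vec_anticomm u v :
  kingdon_vec u ** kingdon_vec v + kingdon_vec v ** kingdon_vec u = 0.
Proof.
have [_ _ qM] := kclass_morphism.
have := kclass_relator (kingdon_anticomm (@zero_form F V) u v).
by rewrite scale0r subr0 (alg_morphD kclass_morphism) !qM.
Qed.

Lemma kingdon_vec_reverse u v w :
  (kingdon_vec u ** kingdon_vec v) ** kingdon_vec w
    = kingdon_vec w ** (kingdon_vec v ** kingdon_vec u).
Proof.
have [_ _ qM] := kclass_morphism.
have := kclass_relator (kingdon_reverse (@zero_form F V) u v w).
by rewrite (alg_morphB kclass_morphism) !qM => /eqP; rewrite subr_eq0 => /eqP.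
Qed.

Lemma Kingdon_alternative : alternative K.
Proof. exact/alg_quot_alternative/Alt_alternative. Qed.

(** Composed with the projection from [Alt V], both [h] and the identity extend [kingdon_vec];
    uniqueness in the universal property makes them agree. *)
Lemma kingdon_endo_id (h : K -> K) :
  alg_morphism h -> (forall v, h (kingdon_vec v) = kingdon_vec v) -> h =1 id.
Proof.
move=> hP hv x; rewrite -[x]quot_reprK.
have [f [_ _ fU]] := Alt_universal Kingdon_alternative kingdon_vec_linear.
have hq := alg_morphism_comp hP kclass_morphism.
rewrite -[LHS]/((h \o kclass) (quot_repr x)) (fU _ hq) //.
by rewrite (fU _ kclass_morphism).
Qed.

End KingdonZero.

(** The extension of [lambda_vec] to the free alternative algebra kills both kinds of relators,
    hence factors through the quotient. *)
Lemma kingdon_to_lambda (F : fieldType) :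
  exists2 g : Kingdon (@zero_form F 'rV[F]_3) -> Lambda' F,
    alg_morphism g & forall v, g (kingdon_vec v) = lambda_vec v.
Proof.
have [f [fP fv _]] :=
  Alt_universal (@Lambda'_alternative F) (@lambda_vec_linear F).
have [_ _ fM] := fP.
have [g gP gq] : exists2 g : Kingdon (@zero_form F 'rV[F]_3) -> Lambda' F,
    alg_morphism g & forall x, g (quot_class _ x) = f x.
  apply: alg_quot_lift => //; apply: (alg_morph_ideal_gen fP) => x [u v|u v w].
    rewrite scale0r subr0 (alg_morphD fP) !fM !fv.
    exact: lambda_vec_anticomm.
  by rewrite (alg_morphB fP) !fM !fv lambda_vec_reverse subrr.
by exists g => // v; rewrite gq fv.
Qed.

Theorem proposition4p6 (F : fieldType) (two_unit : (2 : F) \is a GRing.unit) :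
  alg_isomorphic (Lambda' F) (Kingdon (@zero_form F 'rV[F]_3)).
Proof.
pose e (u : 'I_3) := kingdon_vec (delta_mx 0 u : 'rV[F]_3).
have fP : alg_morphism (lambda_ext e).
  apply: lambda_ext_morphism => // [|u v|u v w].
  - exact: Kingdon_alternative.
  - exact: kingdon_vec_anticomm.
  - exact: kingdon_vec_reverse.
have [g gP gv] := kingdon_to_lambda F; have [_ g1 gM] := gP.
have gfP := alg_morphism_comp gP fP; have fgP := alg_morphism_comp fP gP.
exists (lambda_ext e) => //; exists g => [x|].
  (* By linearity, it is enough that [g \o lambda_ext e] fixes each basis element. *)
  rewrite -[LHS]/((g \o lambda_ext e) x) [x]lambda_sum_elt (alg_morph_sum gfP).
  apply: eq_bigr => a _; rewrite (alg_morphZ gfP) /= lambda_ext_elt.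
  by case: a; rewrite /= ?g1 ?gM ?gv ?lambda_vec_delta //= /namul /=
    !lambda_mul_elt /= ?lambda_mul_elt.
apply: (kingdon_endo_id fgP) => v /=; rewrite gv.
(* Only the coordinates of [lambda_vec v] at [Li], [Lj] and [Lk] survive; what remains is the
   expansion of [v] in the standard basis. *)
rewrite /lambda_ext lambda_basis_sum !ffunE !scale0r !addr0 add0r /= /e.
have kl := @kingdon_vec_linear F 'rV[F]_3.
have o0 : inord 0 = ord0 :> 'I_3 by apply: val_inj; rewrite /= inordK.
have o1 : inord 1 = lift ord0 ord0 :> 'I_3.
  by apply: val_inj; rewrite /= inordK.
have o2 : inord 2 = lift ord0 (lift ord0 ord0) :> 'I_3.
  by apply: val_inj; rewrite /= inordK.
rewrite [in RHS](row_sum_delta v) !big_ord_recl big_ord0 o0 o1 o2.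
have k0 : kingdon_vec (0 : 'rV[F]_3) = 0.
  by have := kl (-1) 0 0; rewrite scaler0 addr0 scaleN1r addNr.
by rewrite !kl k0 addr0 addrA.
Qed.
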